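(* Let $H=\sum_{ij}h_{ij}$ be a translational invariant, frustration free, local Hamiltonian on a 2D $N\times M$ square lattice, where $h$ is a locally acting projector and $h_{ij}$ is its translate by $i$ columns and $j$ rows. Let $I\subset\{1,\dots,N\}\times\{1,\dots,M\}$ be a small set such that $h\,h_{ij}\ge0$ whenever $(i,j)\notin I$ (such a set exists since $H$ is local). If $H$ has a unique ground state (i.e., it is the parent Hamiltonian of an injective PEPS) and $$\sum_{(i,j)\in I}\left(h\,h_{ij}+h_{ij}\,h\right)>-\frac{1}{|I|+1}\Big(h+\sum_{(i,j)\in I}h_{ij}\Big),$$ then there is an $\epsilon>0$ such that $H^2>\epsilon H$, and hence there is a uniform (independent of the size of the system) energy gap for $H$.
   Context: Inequalities between operators refer to the matrix ordering, and local operators are identified with their tensor products with the identity on the remaining sites. Frustration free means that the ground state minimizes the energy of every interaction term $h_{ij}$ separately. A PEPS on a lattice is a state $\sum_{i_1,i_2,\dots}\mathcal{C}[\{A^{(v)}_{i_v}\}_v]\,|i_1,i_2,\dots\rangle$, where each site $v$ carries tensors $A^{(v)}_i$, $i=1,\dots,d$, with one $D$-valued index per edge at $v$, and $\mathcal{C}$ denotes contraction along the edges. For a region $R$ with $e_R$ edges to its exterior, let $A_{i_R}$ be the contraction of the tensors in $R$ along the edges inside $R$, and define $\Gamma_R:\mathbb{C}^{D^{e_R}}\to\mathbb{C}^{d^{|R|}}$ by $\Gamma_R(C)=\sum_{i_R}\mathcal{C}[A_{i_R}C]\,|i_R\rangle$, with $G_R=\mathrm{range}(\Gamma_R)$. A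 connected region $R$ is injective if $\Gamma_R$ is injective, and the PEPS is injective if there is a proper covering of the lattice by disjoint injective regions $R_\alpha$. A parent Hamiltonian of an injective PEPS is a sum of terms $h_{\alpha,\beta}\otimes\mathbb{1}$ over pairs of regions connected by an edge, with $h_{\alpha,\beta}\ge0$ acting on $R_\alpha\cup R_\beta$ and $\ker(h_{\alpha,\beta})=G_{R_\alpha\cup R_\beta}$; the PEPS is its unique ground state. *)

(* Defs.v *)
From HB Require Import structures.
From mathcomp Require Import all_boot all_order all_algebra.
From mathcomp Require Import reals complex.

Set Implicit Arguments.
Unset Strict Implicit.
Unset Printing Implicit Defensive.

Import Order.TTheory GRing.Theory Num.Theory.
Local Open Scope ring_scope.
Local Open Scope sesquilinear_scope.

Section Operators.
Variable C : numClosedFieldType.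

Definition expect n (A : 'M[C]_n) (v : 'cV[C]_n) : C :=
  (v ^t* *m A *m v) ord0 ord0.

Definition normalized n (v : 'cV[C]_n) : Prop := (v ^t* *m v) ord0 ord0 = 1.

(* In [C], [0 <= z] includes that [z] is real, so this forces [A] to be
   Hermitian. *)
Definition op_ge0 n (A : 'M[C]_n) : Prop := forall v, 0 <= expect A v.

(* The strict matrix ordering between operators which share ground states of
   energy zero: both sides of such an inequality vanish on the common kernel,
   where strictness is impossible, so it is asked for every other vector. *)
Definition op_gt n (A B : 'M[C]_n) : Prop :=
  forall v, ~ (A *m v = 0 /\ B *m v = 0) -> expect B v < expect A v.

Definition is_projector n (A : 'M[C]_n) : Prop := A *m A = A /\ A ^t* = A.

Definition minimizes_energy n (A : 'M[C]_n) (v : 'cV[C]_n) : Prop :=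
  normalized v /\ forall w, normalized w -> expect A v <= expect A w.

Definition unique_ground_state n (H : 'M[C]_n) : Prop :=
  exists2 v, minimizes_energy H v &
    forall w, minimizes_energy H w -> exists c, w = c *: v.

Definition energy_gap n (H : 'M[C]_n) (gap : C) : Prop :=
  forall v, minimizes_energy H v ->
  forall E, eigenvalue H E -> E != expect H v -> expect H v + gap <= E.

End Operators.

(* Operators on the tensor product of copies of C^d over the sites of [T], as
   matrices in the basis of product states [{ffun T -> 'I_d}]. *)
Notation op C d T := 'M[C]_#|{ffun T -> 'I_d}|.

Section Locality.
Variables (C : numClosedFieldType) (d : nat).

(* For injective [f], the operator [h], acting on the sites [f p] instead of
   [p], tensored with the identity on the sites outside the image of [f]. *)
Definition embed (P T : finType) (f : P -> T) (h : op C d P) : op C d T :=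
  \matrix_(a, b)
    let x : {ffun T -> 'I_d} := enum_val a in
    let y : {ffun T -> 'I_d} := enum_val b in
    h (enum_rank [ffun p => x (f p)]) (enum_rank [ffun p => y (f p)])
    *+ [forall t, (t \notin codom f) ==> (x t == y t)].

End Locality.

(* N.+1 columns and M.+1 rows with periodic boundary conditions; a site is a
   pair (column, row), and the group structure is that of translations. *)
Notation torus N M := ('I_N.+1 * 'I_M.+1)%type.

Section SquareLattice.
Variables (C : numClosedFieldType) (d N M : nat).

Definition place (r s : nat) (ij : torus N M) (p : 'I_r * 'I_s) : torus N M :=
  (inZp p.1, inZp p.2) + ij.

Definition translate (r s : nat) (h : op C d ('I_r * 'I_s)) (ij : torus N M) :
    op C d (torus N M) :=
  embed (place ij) h.

Definition hamiltonian (r s : nat) (h : op C d ('I_r * 'I_s)) :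
    op C d (torus N M) :=
  \sum_(ij : torus N M) translate h ij.

Definition frustration_free (r s : nat) (h : op C d ('I_r * 'I_s)) : Prop :=
  forall v, minimizes_energy (hamiltonian h) v ->
  forall ij : torus N M, minimizes_energy (translate h ij) v.

(* The edge [(v, k)] joins [v] to [v + step k]. *)
Definition edge : finType := (torus N M * bool)%type.
Definition step (k : bool) : torus N M :=
  if k then (0, inZp 1) else (inZp 1, 0).
Definition src (b : edge) : torus N M := b.1.
Definition tgt (b : edge) : torus N M := b.1 + step b.2.

Definition adjacent (x y : torus N M) : bool :=
  [exists b : edge, ((src b == x) && (tgt b == y))
                 || ((src b == y) && (tgt b == x))].

Definition connected_region (R : {set torus N M}) : Prop :=
  {in R &, forall x y,
     connect [rel u v | [&& u \in R, v \in R & adjacent u v]] x y}.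

Definition touches (R : {set torus N M}) (b : edge) : bool :=
  (src b \in R) || (tgt b \in R).
Definition exterior_edge (R : {set torus N M}) (b : edge) : bool :=
  (src b \in R) != (tgt b \in R).

(* A leg of a site is a direction [k] and an orientation: it is incoming for
   the edge [(v - step k, k)] and outgoing for the edge [(v, k)]. *)
Definition tensor (D : nat) := 'I_d -> {ffun bool * bool -> 'I_D} -> C.

Lemma touches_out (R : {set torus N M}) (v : {x | x \in R}) (k : bool) :
  touches R (val v, k).
Proof. by rewrite /touches (valP v). Qed.

Lemma touches_in (R : {set torus N M}) (v : {x | x \in R}) (k : bool) :
  touches R (val v - step k, k).
Proof. by rewrite /touches /tgt /= subrK (valP v) orbT. Qed.

Definition legs (D : nat) (R : {set torus N M})
    (e : {ffun {b | touches R b} -> 'I_D}) (v : {x | x \in R}) :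
    {ffun bool * bool -> 'I_D} :=
  [ffun kl =>
     e (if kl.2 then exist (fun b => touches R b) _ (touches_in v kl.1)
        else exist (fun b => touches R b) _ (touches_out v kl.1))].

(* The map Gamma_R: a column is a labelling of the edges leaving R, a row is a
   product state of R, and the edges inside R are summed over. *)
Definition Gamma (D : nat) (A : torus N M -> tensor D) (R : {set torus N M}) :
    'M[C]_(#|{ffun {x | x \in R} -> 'I_d}|,
           #|{ffun {b | exterior_edge R b} -> 'I_D}|) :=
  \matrix_(a, b)
    let i : {ffun {x | x \in R} -> 'I_d} := enum_val a in
    let c : {ffun {b | exterior_edge R b} -> 'I_D} := enum_val b in
    \sum_(e : {ffun {b | touches R b} -> 'I_D} |
            [forall t, forall u, (val t == val u) ==> (e t == c u)])
      \prod_(v : {x | x \in R}) A (val v) (i v) (legs e v).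

Definition injective_region (D : nat) (A : torus N M -> tensor D)
    (R : {set torus N M}) : Prop :=
  connected_region R /\
  injective (fun X : 'cV[C]_#|{ffun {b | exterior_edge R b} -> 'I_D}| =>
               Gamma A R *m X).

(* [Q] is an unordered pair of distinct regions connected by an edge. *)
Definition neighbouring_pair (P Q : {set {set torus N M}}) : bool :=
  [&& Q \subset P, #|Q| == 2 &
      [exists b : edge, [exists R1 in Q, exists R2 in Q,
         [&& R1 != R2, src b \in R1 & tgt b \in R2]]]].

(* For a pair Q = [set R1; R2], [cover Q] is the union of R1 and R2. *)
Definition injective_PEPS_parent (H : op C d (torus N M)) : Prop :=
  exists (D : nat) (A : torus N M -> tensor D) (P : {set {set torus N M}})
         (h : forall Q : {set {set torus N M}}, op C d {x | x \in cover Q}),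
    [/\ (0 < D)%N,
        partition P [set: torus N M] /\ (1 < #|P|)%N,
        forall R, R \in P -> injective_region A R,
        forall Q, neighbouring_pair P Q ->
          op_ge0 (h Q) /\
          forall v : 'cV[C]_#|{ffun {x | x \in cover Q} -> 'I_d}|,
            h Q *m v = 0 <-> exists X, v = Gamma A (cover Q) *m X
      & H = \sum_(Q | neighbouring_pair P Q) embed val (h Q)].

End SquareLattice.

(* Main.v *)
(** Pairing each product with its reverse, 2 <H^2> is the sum over all
    displacements j and base points k of <h_k h_(k+j) + h_(k+j) h_k>.  The
    displacement 0 contributes 2 <H>, those outside [I] contribute nonnegative
    terms, and those in [I] contribute at least -<H>, by the translates of the
    local bound, in which each h_k is counted |I| + 1 times.  Hence
    <H^2> >= <H> / 2, and H^2 > eps H for any eps < 1/2.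

    For the gap, a ground state minimizes every projector h_k: either some h_k,
    hence each of them, is the identity and H has a single eigenvalue, or the
    ground energy is 0 and H^2 >= eps H excludes eigenvalues in ]0, eps[. *)
Require Import Defs.
From HB Require Import structures.
From mathcomp Require Import all_boot all_order all_algebra.
From mathcomp Require Import reals complex.

Import Order.TTheory GRing.Theory Num.Theory.
Local Open Scope ring_scope.

(** * Expectation values, projectors, and eigenvalues of a positive operator *)

Section Expectation.
Local Set Implicit Arguments.
Local Open Scope sesquilinear_scope.
Variables (C : numClosedFieldType) (n : nat).
Implicit Types (A B : 'M[C]_n) (v w : 'cV[C]_n).

Lemma adjmxM m p q (A : 'M[C]_(m, p)) (B : 'M[C]_(p, q)) :
  (A *m B) ^t* = B ^t* *m A ^t*.
Proof. by rewrite trmx_mul map_mxM. Qed.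

Definition sqnorm v : C := (v ^t* *m v) ord0 ord0.

Lemma sqnormE v : sqnorm v = \sum_i `|v i ord0| ^+ 2.
Proof.
by rewrite /sqnorm mxE; apply: eq_bigr => i _; rewrite !mxE mulrC -normCK.
Qed.

Lemma sqnorm_ge0 v : 0 <= sqnorm v.
Proof. by rewrite sqnormE sumr_ge0 // => i _; rewrite exprn_ge0. Qed.

Lemma sqnorm_eq0 v : (sqnorm v == 0) = (v == 0).
Proof.
apply/eqP/eqP=> [|->]; last by rewrite /sqnorm mulmx0 mxE.
rewrite sqnormE => /eqP; rewrite psumr_eq0 => [/allP v0|i _]; last first.
  by rewrite exprn_ge0.
apply/colP => i; rewrite mxE; apply/eqP.
by have := v0 i (mem_index_enum i); rewrite sqrf_eq0 normr_eq0.
Qed.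

Lemma expectD A B v : expect (A + B) v = expect A v + expect B v.
Proof. by rewrite /expect mulmxDr mulmxDl mxE. Qed.

Lemma expectZ a A v : expect (a *: A) v = a * expect A v.
Proof. by rewrite /expect -scalemxAr -scalemxAl mxE. Qed.

Lemma expect_sum (J : finType) (P : pred J) (F : J -> 'M[C]_n) v :
  expect (\sum_(j | P j) F j) v = \sum_(j | P j) expect (F j) v.
Proof.
elim/big_rec2: _ => [|j a B _ <-]; last by rewrite expectD.
by rewrite /expect mulmx0 mul0mx mxE.
Qed.

Lemma expect_adj A v : expect (A ^t*) v = Num.conj (expect A v).
Proof.
have -> : Num.conj (expect A v) = ((v ^t* *m A *m v) ^t*) ord0 ord0.
  by rewrite /expect !mxE.
by rewrite /expect !adjmxM trmxCK mulmxA.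
Qed.

Lemma expect_eigen A (a : C) v : A *m v = a *: v -> expect A v = a * sqnorm v.
Proof. by move=> Av; rewrite /expect -mulmxA Av -scalemxAr mxE. Qed.

Lemma expect_ker A v : A *m v = 0 -> expect A v = 0.
Proof. by move=> Av; rewrite /expect -mulmxA Av mulmx0 mxE. Qed.

(** A permutation of the basis is unitary, so conjugating by it can be moved onto the vector.
    Translations enter the estimates in this form. *)
Lemma expect_mxsub A (f g : 'I_n -> 'I_n) v : cancel f g -> cancel g f ->
  expect (mxsub f f A) v = expect A (rowsub g v).
Proof.
move=> fK gK; rewrite /expect !mxE (reindex g) /=; last first.
  by exists f => i _; rewrite ?fK ?gK.
apply: eq_bigr => j _; rewrite !mxE; congr (_ * _).
rewrite (reindex g) /=; last by exists f => i _; rewrite ?fK ?gK.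
by apply: eq_bigr => i _; rewrite !mxE !gK.
Qed.

Lemma mxsub_mul_bij A B (f : 'I_n -> 'I_n) : bijective f ->
  mxsub f f (A *m B) = mxsub f f A *m mxsub f f B.
Proof.
move=> [g fK gK]; apply/matrixP => i j; rewrite !mxE (reindex f) /=.
  by apply: eq_bigr => k _; rewrite !mxE.
by exists g => k _; rewrite ?fK ?gK.
Qed.

Lemma op_gt_ge A B v : op_gt A B -> expect B v <= expect A v.
Proof.
move=> AB; have [/andP[/eqP A0 /eqP B0]|nAB] :=
  boolP ((A *m v == 0) && (B *m v == 0)); first by rewrite !expect_ker.
by apply/ltW/AB => -[A0 B0]; rewrite A0 B0 eqxx in nAB.
Qed.

Lemma expect_projector A v : is_projector A -> expect A v = sqnorm (A *m v).
Proof.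
by move=> [AA Aa]; rewrite /sqnorm adjmxM Aa mulmxA -(mulmxA _ A A) AA.
Qed.

Lemma expect_sqr A v : A ^t* = A -> expect (A *m A) v = sqnorm (A *m v).
Proof. by move=> Aa; rewrite /sqnorm adjmxM Aa !mulmxA /expect !mulmxA. Qed.

Lemma normalized_scaled v : v != 0 -> exists a : C, normalized (a *: v).
Proof.
move=> v0; exists (sqrtC (sqnorm v))^-1; set a := _^-1.
have nv : sqnorm v != 0 by rewrite sqnorm_eq0.
rewrite /normalized -/(sqnorm _) sqnormE.
under eq_bigr => i _ do rewrite mxE normrM exprMn.
rewrite -mulr_sumr -sqnormE /a normfV exprVn.
by rewrite ger0_norm ?sqrtC_ge0 ?sqnorm_ge0// sqrtCK mulVf.
Qed.

(** If [A] is not the identity, some column of [1 - A] is nonzero; [A] kills it since [A] is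
    idempotent. Scaled to norm 1 it has energy 0, which forces the minimum [sqnorm (A *m v)] to be
    0. *)
Lemma projector_minimizer A v : is_projector A -> minimizes_energy A v ->
  A = 1%:M \/ A *m v = 0.
Proof.
move=> Ap [_ Av]; have [AA _] := Ap; have [->|A1] := eqVneq A 1%:M; first by left.
right; have [i Ai] : exists i, col i (1%:M - A) != 0.
  apply/existsP; apply: contraNT A1; rewrite negb_exists => /forallP A0.
  rewrite eq_sym -subr_eq0; apply/eqP/matrixP => j i.
  by have /eqP/colP/(_ j) := negPn (A0 i); rewrite !mxE.
have [a /Av] := normalized_scaled _ Ai.
rewrite [leRHS]expect_ker; last first.
  by rewrite colE -scalemxAr mulmxA mulmxBr mulmx1 AA subrr mul0mx scaler0.
rewrite expect_projector // => le0; apply/eqP.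
by rewrite -sqnorm_eq0 eq_le le0 sqnorm_ge0.
Qed.

(** On an eigenvector the operator inequality reads [e * E <= E ^+ 2], and [E] is positive. *)
Lemma gap_of_sqr_gt A (e : C) : A ^t* = A -> op_ge0 A -> 0 < e ->
    op_gt (A *m A) (e *: A) ->
  forall E, eigenvalue A E -> E != 0 -> e <= E.
Proof.
move=> Aa A0 e0 AA E /eigenvalueP[u uA u0] E0.
(* [eigenvalue] supplies a row vector. Its adjoint is a column eigenvector for the conjugate of [E],
   and positivity of [A] then makes [E] real. *)
pose v := u ^t*; have v0 : 0 < sqnorm v.
  rewrite lt_def sqnorm_ge0 sqnorm_eq0 andbT.
  by apply: contraNneq u0 => vz; rewrite -(trmxCK u) -/v vz trmx0 map_mx0.
have Av : A *m v = Num.conj E *: v.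
  by rewrite -[X in X *m _]Aa -adjmxM uA linearZ /= map_mxZ.
have cE_ge0 : 0 <= Num.conj E.
  by rewrite -(pmulr_lge0 _ v0) -(expect_eigen Av).
have cE : Num.conj E = E by rewrite -[RHS]conjCK (geC0_conj cE_ge0).
rewrite cE in Av cE_ge0.
have Egt0 : 0 < E by rewrite lt_def E0.
have AAv : (A *m A) *m v = (E ^+ 2) *: v.
  by rewrite -mulmxA Av -scalemxAr Av scalerA.
have := op_gt_ge v AA; rewrite expectZ (expect_eigen AAv) (expect_eigen Av).
by rewrite mulrA ler_pM2r // expr2 ler_pM2r.
Qed.
End Expectation.

(** * Operators acting on part of the sites, and permutations of the sites *)

Section Embedding.
Local Set Implicit Arguments.
Local Open Scope sesquilinear_scope.
Variables (C : numClosedFieldType) (d : nat) (P T : finType) (f : P -> T).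

Lemma embed_adj (h : op C d P) : (embed f h) ^t* = embed f (h ^t*).
Proof.
apply/matrixP => a b; rewrite !mxE raddfMn; congr (_ *+ nat_of_bool _).
  by rewrite !mxE.
by apply: eq_forallb => t; rewrite eq_sym.
Qed.

Lemma eq_embed (f' : P -> T) (h : op C d P) : f =1 f' -> embed f h = embed f' h.
Proof.
move=> ff'; apply/matrixP => a b; rewrite !mxE; cbv zeta.
have E (x : {ffun T -> 'I_d}) : [ffun p => x (f p)] = [ffun p => x (f' p)].
  by apply/ffunP => p; rewrite !ffunE ff'.
rewrite !E; congr (_ *+ nat_of_bool _).
by apply: eq_forallb => t; rewrite (eq_codom ff').
Qed.

(** An intermediate configuration contributes only if it agrees with [a] outside the range of [f],
    and such configurations correspond to those of [P]. *)
Lemma embed_mul (g h : op C d P) : injective f ->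
  embed f (g *m h) = embed f g *m embed f h.
Proof.
move=> f_inj; apply/matrixP => a b.
pose restr (c : 'I_#|{ffun T -> 'I_d}|) : 'I_#|{ffun P -> 'I_d}| :=
  enum_rank [ffun p => (enum_val c : {ffun T -> 'I_d}) (f p)].
(* [glue] inverts [restr] on the configurations that agree with [a] outside the
   range of [f]. *)
pose glue (q : 'I_#|{ffun P -> 'I_d}|) : 'I_#|{ffun T -> 'I_d}| :=
  enum_rank [ffun t => if [pick p | f p == t] is Some p
    then (enum_val q : {ffun P -> 'I_d}) p
    else (enum_val a : {ffun T -> 'I_d}) t].
pose agree (x y : {ffun T -> 'I_d}) :=
  [forall t, (t \notin codom f) ==> (x t == y t)].
have glueK : cancel glue restr.
  move=> q; rewrite /restr /glue enum_rankK; apply: (canLR (@enum_valK _)).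
  apply/ffunP => p; rewrite !ffunE; case: pickP => [p' /eqP/f_inj -> //|].
  by move/(_ p); rewrite eqxx.
have agree_glue q : agree (enum_val a) (enum_val (glue q)).
  apply/forallP => t; apply/implyP => tf; rewrite enum_rankK ffunE.
  by case: pickP => // p /eqP pt; rewrite -pt codom_f in tf.
have restrK c : agree (enum_val a) (enum_val c) -> glue (restr c) = c.
  move=> ac; rewrite /restr /glue; apply: (canLR (@enum_valK _)).
  apply/ffunP => t; rewrite !ffunE; case: pickP => [p /eqP pt|nt].
    by rewrite enum_rankK ffunE pt.
  apply/eqP/(implyP (forallP ac t)); apply/codomP => -[p tp].
  by have := nt p; rewrite -tp eqxx.
have embedE k c c' : embed f k c c' =
    k (restr c) (restr c') *+ agree (enum_val c) (enum_val c') by rewrite mxE.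
rewrite embedE !mxE.
transitivity (\sum_(c | agree (enum_val a) (enum_val c))
    g (restr a) (restr c) *
    (h (restr c) (restr b) *+ agree (enum_val c) (enum_val b))); last first.
  rewrite big_mkcond; apply: eq_bigr => c _; rewrite !embedE.
  by case: (agree _ (enum_val c)); rewrite ?mulr1n ?mulr0n ?mul0r.
rewrite (reindex_onto glue restr) /= ?sumrMnl; last exact: restrK.
rewrite -sumrMnl; apply: eq_big => [q|q _]; first by rewrite agree_glue glueK eqxx.
(* Outside the range of [f], [glue q] equals [a], so it agrees with [b] there exactly when [a]
   does. *)
rewrite glueK mulrnAr; congr (_ *+ nat_of_bool _).
apply: eq_forallb => t; have [//|tf] := boolP (t \in codom f).
by rewrite (eqP (implyP (forallP (agree_glue q) t) tf)).
Qed.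

Lemma embed_projector (h : op C d P) : injective f ->
  is_projector h -> is_projector (embed f h).
Proof. by move=> fi [hh ha]; split; rewrite ?embed_adj ?ha // -embed_mul ?hh. Qed.
End Embedding.

(** A bijection of the sites permutes the product states by precomposition. [F] is chosen before
    [P], [f] and [h], so one permutation moves all local operators at once. *)
Lemma embed_comp (C : numClosedFieldType) d (T : finType) (g g' : T -> T) :
    cancel g g' -> cancel g' g ->
  exists2 F : 'I_#|{ffun T -> 'I_d}| -> 'I_#|{ffun T -> 'I_d}|, bijective F &
    forall (P : finType) (f : P -> T) (h : op C d P),
       embed (g \o f) h = mxsub F F (embed f h).
Proof.
move=> gK g'K.
pose shift (k : T -> T) (c : 'I_#|{ffun T -> 'I_d}|) : 'I_#|{ffun T -> 'I_d}| :=
  enum_rank [ffun t => (enum_val c : {ffun T -> 'I_d}) (k t)].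
have shiftK k k' : cancel k k' -> cancel (shift k') (shift k).
  move=> kK c; rewrite /shift enum_rankK; apply: (canLR (@enum_valK _)).
  by apply/ffunP => t; rewrite !ffunE kK.
exists (shift g); first by exists (shift g'); apply: shiftK.
move=> P f h; apply/matrixP => a b; rewrite !mxE !enum_rankK; cbv zeta.
have E c : [ffun p => [ffun t => (enum_val c : {ffun T -> 'I_d}) (g t)] (f p)]
         = [ffun p => (enum_val c : {ffun T -> 'I_d}) ((g \o f) p)].
  by apply/ffunP => p; rewrite !ffunE.
rewrite !E; congr (_ *+ nat_of_bool _).
have codomg t : (g t \in codom (g \o f)) = (t \in codom f).
  apply/codomP/codomP => -[p]; first by move/(can_inj gK) ->; exists p.
  by move->; exists p.
apply/forallP/forallP => ab t; apply/implyP.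
  by move=> tf; have := ab (g t); rewrite codomg tf !ffunE.
by move=> tf; have := ab (g' t); rewrite -codomg !ffunE g'K tf.
Qed.

(** * Sums of translates of one projector over a finite abelian group *)

Section TranslationInvariant.
Local Set Implicit Arguments.
Local Open Scope sesquilinear_scope.
Variables (C : numClosedFieldType) (n : nat) (T : finZmodType).
Variable hh : T -> 'M[C]_n.
Hypothesis hh_proj : forall k, is_projector (hh k).
(** Translation by [k] acts as a permutation [F] of the basis. [F] does not depend on [j], so
    products of two translates are carried along too. *)
Hypothesis hh_covariant : forall k : T,
  exists2 F : 'I_n -> 'I_n, bijective F &
    forall j, hh (j + k) = mxsub F F (hh j).
Let H : 'M[C]_n := \sum_k hh k.

Lemma sum_projectors_adj : H ^t* = H.
Proof.
rewrite /H !raddf_sum; apply: eq_bigr => k _.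
by have [_] := hh_proj k.
Qed.

Lemma sum_projectors_ge0 : op_ge0 H.
Proof.
move=> v; rewrite expect_sum sumr_ge0 // => k _.
by rewrite expect_projector ?sqnorm_ge0.
Qed.

Lemma sum_translates_eq1 k : hh k = 1%:M -> H = #|T|%:R%:M.
Proof.
move=> hk1; have hh1 j : hh j = 1%:M.
  have [F Fb FE] := hh_covariant (j - k).
  have := FE k; rewrite addrC subrK hk1 => ->.
  by apply/matrixP => a b; rewrite !mxE (bij_eq Fb).
rewrite /H (eq_bigr _ (fun j _ => hh1 j)) sumr_const.
by rewrite -raddfMn.
Qed.

Lemma frustration_free_gap (e : C) :
    (forall v, minimizes_energy H v -> forall k, minimizes_energy (hh k) v) ->
    0 < e -> op_gt (H *m H) (e *: H) -> energy_gap H e.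
Proof.
move=> ff e0 HH v vmin E HE; have [[v1 _] hv] := (vmin, ff v vmin).
(* If some projector is the identity, [H] is scalar and no eigenvalue differs from the ground
   energy. *)
have [[k /eqP hk1]|nh1] := altP (@existsP _ (fun k => hh k == 1%:M)).
  have Hs := sum_translates_eq1 hk1.
  have Ev : expect H v = #|T|%:R.
    rewrite (@expect_eigen _ _ _ #|T|%:R) ?Hs ?mul_scalar_mx //.
    by rewrite /sqnorm v1 mulr1.
  have /eigenvalueP[u uH u0] := HE.
  rewrite Ev; suff -> : E = #|T|%:R by rewrite eqxx.
  move: uH; rewrite Hs mul_mx_scalar => /eqP.
  rewrite -subr_eq0 -scalerBl scaler_eq0 (negPf u0) orbF subr_eq0.
  by move=> /eqP.
have hv0 k : hh k *m v = 0.
  have [hk1|//] := projector_minimizer (hh_proj k) (hv k).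
  by case/existsP: nh1; exists k; apply/eqP.
have -> : expect H v = 0.
  by rewrite expect_ker // /H mulmx_suml big1.
rewrite add0r; apply: gap_of_sqr_gt HE => //.
  exact: sum_projectors_adj.
exact: sum_projectors_ge0.
Qed.

Lemma expect_sqr_sum v : expect (H *m H) v *+ 2 =
  \sum_j \sum_k expect (hh k *m hh (j + k) + hh (j + k) *m hh k) v.
Proof.
have HH : expect (H *m H) v = \sum_k \sum_l expect (hh k *m hh l) v.
  rewrite /H mulmx_suml expect_sum; apply: eq_bigr => k _.
  by rewrite mulmx_sumr expect_sum.
(* One of the two copies of the double sum has its indices swapped, which pairs each product with
   its reverse; then [l] is replaced by [j + k]. *)
rewrite mulr2n {2}HH exchange_big HH -big_split exchange_big /=.
apply: eq_bigr => k _; rewrite -big_split (reindex_inj (addIr k)) /=.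
by apply: eq_bigr => j _; rewrite expectD.
Qed.

Lemma sqr_ge_half (I : {set T}) : 0 \notin I ->
    (forall j, j \notin I -> op_ge0 (hh 0 *m hh j)) ->
    op_gt (\sum_(j in I) (hh 0 *m hh j + hh j *m hh 0))
          (- (#|I|.+1%:R^-1) *: (hh 0 + \sum_(j in I) hh j)) ->
  forall v, expect H v <= expect (H *m H) v *+ 2.
Proof.
move=> I0 comm_ge0 bound v; rewrite expect_sqr_sum exchange_big /=.
(* [w k] is [v] translated back by [k]: it turns the terms with base point [k] into terms with base
   point 0, where the hypotheses apply. *)
have [w wE] : exists w : T -> 'cV[C]_n, forall k,
    (forall j, expect (hh (j + k)) v = expect (hh j) (w k)) /\
    forall j, expect (hh k *m hh (j + k) + hh (j + k) *m hh k) v =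
      expect (hh 0 *m hh j + hh j *m hh 0) (w k).
  suff /fin_all_exists[w wE] : forall k, exists w : 'cV[C]_n,
      (forall j, expect (hh (j + k)) v = expect (hh j) w) /\
      forall j, expect (hh k *m hh (j + k) + hh (j + k) *m hh k) v =
        expect (hh 0 *m hh j + hh j *m hh 0) w by exists w.
  move=> k; have [F Fb FE] := hh_covariant k; have [g Fg gF] := Fb.
  exists (rowsub g v); split=> j; rewrite ?FE ?(expect_mxsub _ _ _ Fg gF) //.
  have hk : hh k = mxsub F F (hh 0) by rewrite -FE add0r.
  rewrite hk -!mxsub_mul_bij // -(expect_mxsub _ _ _ Fg gF).
  by congr expect; apply/matrixP => a b; rewrite !mxE.
have local_bound u : 2 * expect (hh 0) u
    - #|I|.+1%:R^-1 * (expect (hh 0) u + \sum_(j in I) expect (hh j) u)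
    <= \sum_j expect (hh 0 *m hh j + hh j *m hh 0) u.
  rewrite [leRHS](bigID (mem I)) [leRHS]addrC /=; apply: lerD; last first.
    rewrite -[leRHS]expect_sum -mulNr -expect_sum -expectD -expectZ.
    exact: op_gt_ge.
  have [h00 h0a] := hh_proj 0.
  (* Since 0 lies outside [I], this half of the sum contains displacement 0, which gives twice the
     expectation of [hh 0] by idempotence. *)
  rewrite (bigD1 0) //= h00 expectD -mulr2n mulr_natl lerDl.
  apply: sumr_ge0 => j /andP[jI _]; have [_ hja] := hh_proj j.
  have ge0 := comm_ge0 j jI u.
  (* The reversed product is the adjoint, so its expectation is the conjugate of a nonnegative
     number. *)
  rewrite expectD addr_ge0 // -[hh 0]h0a -[hh j]hja -adjmxM expect_adj.
  by rewrite conjC_ge0.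
have sum_w j : \sum_k expect (hh j) (w k) = expect H v.
  rewrite /H expect_sum [RHS](reindex_inj (addrI j)).
  by apply: eq_bigr => k _; have [-> _] := wE k.
(* Each of the [#|I|.+1] terms in the bracket sums over [k] to [expect H v]; the prefactor cancels
   this count, and 2 - 1 = 1 copy is left. *)
have -> : expect H v = \sum_k (2 * expect (hh 0) (w k)
    - #|I|.+1%:R^-1
      * (expect (hh 0) (w k) + \sum_(j in I) expect (hh j) (w k))).
  rewrite sumrB -!mulr_sumr big_split exchange_big /= !sum_w.
  rewrite (eq_bigr _ (fun j _ => sum_w j)) sumr_const -mulrS.
  rewrite -[expect H v *+ _.+1]mulr_natl.
  by rewrite mulKf ?pnatr_eq0 // mulr_natl mulr2n addrK.
apply: ler_sum => k _; apply: le_trans (local_bound (w k)) _.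
rewrite le_eqVlt; apply/orP; left; apply/eqP/eq_bigr => j _.
by have [_ ->] := wE k.
Qed.

(** Going from 1/2 down to 1/4 buys strictness: off the kernel of [H], the expectation of [H *m H]
    is a positive squared norm. *)
Lemma sqr_gt_quarter (I : {set T}) : 0 \notin I ->
    (forall j, j \notin I -> op_ge0 (hh 0 *m hh j)) ->
    op_gt (\sum_(j in I) (hh 0 *m hh j + hh j *m hh 0))
          (- (#|I|.+1%:R^-1) *: (hh 0 + \sum_(j in I) hh j)) ->
  op_gt (H *m H) (4^-1 *: H).
Proof.
move=> I0 comm_ge0 bound v nv.
have Hv : H *m v != 0.
  apply/eqP => Hv; apply: nv; split; first by rewrite -mulmxA Hv mulmx0.
  by rewrite -scalemxAl Hv scaler0.
have half := sqr_ge_half I0 comm_ge0 bound v.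
have HHv : 0 < expect (H *m H) v.
  by rewrite expect_sqr ?sum_projectors_adj // lt_def sqnorm_eq0 Hv sqnorm_ge0.
rewrite expectZ ltr_pdivrMl //; apply: le_lt_trans half _.
by rewrite -[ltLHS]mulr_natl ltr_pM2r // ltr_nat.
Qed.
End TranslationInvariant.

(* The torus only has separate finType and zmodType instances otherwise. *)
HB.instance Definition _ (S T : finZmodType) := GRing.Zmodule.on (S * T)%type.

Local Open Scope complex_scope.

Theorem proposition4 (R : realType) (d r s : nat)
    (h : op R[i] d ('I_r * 'I_s)) (h_proj : is_projector h) :
  exists2 eps : R, 0 < eps &
  forall (N M : nat) (I : {set torus N M}),
    (r <= N.+1)%N -> (s <= M.+1)%N ->
    (0, 0) \notin I ->
    let hh : torus N M -> op R[i] d (torus N M) := translate h in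
    let h0 := hh (0, 0) in
    let H : op R[i] d (torus N M) := hamiltonian N M h in
    frustration_free N M h ->
    (forall ij, ij \notin I -> op_ge0 (h0 *m hh ij)) ->
    unique_ground_state H \/ injective_PEPS_parent H ->
    op_gt (\sum_(ij in I) (h0 *m hh ij + hh ij *m h0))
          (- (#|I|.+1%:R^-1) *: (h0 + \sum_(ij in I) hh ij)) ->
    op_gt (H *m H) (eps%:C *: H) /\ energy_gap H eps%:C.
Proof.
(* The constant is fixed before [N], [M] and [I], which makes the gap uniform. *)
exists 4^-1; first by rewrite invr_gt0 ltr0n.
move=> N M I rN sM I0 hh h0 H ff comm_ge0 _ bound.
(* The [r] by [s] patch fits into the torus, so reduction modulo its side lengths identifies no two
   sites of the patch. *)
have place_inj ij : injective (@place N M r s ij).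
  move=> [a b] [a' b'] /addIr [] /=.
  rewrite !modn_small ?(leq_trans (ltn_ord _)) // => aa bb.
  by congr (_, _); apply: val_inj.
have hh_proj ij : is_projector (hh ij) by exact: embed_projector.
have hh_cov (k : torus N M) : exists2 F : 'I_#|{ffun torus N M -> 'I_d}| -> _,
    bijective F & forall j, hh (j + k) = mxsub F F (hh j).
  (* Placing at [j + k] is placing at [j] followed by the bijection of sites that adds [k]. *)
  have [F Fb FE] := embed_comp R[i] d _ _ _ (addrK k) (subrK k).
  exists F => // j; rewrite -FE.
  by apply: eq_embed => p; rewrite /place /= addrA.
have e0 : 0 < (4^-1 : R)%:C by rewrite ltcR invr_gt0 ltr0n.
have HH : op_gt (H *m H) ((4^-1)%:C *: H).
  have -> : (4^-1 : R)%:C = 4^-1 by rewrite rmorphV ?unitfE ?pnatr_eq0 ?rmorph_nat.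
  exact: (sqr_gt_quarter _ hh_proj hh_cov I0 comm_ge0 bound).
by split=> //; apply: (frustration_free_gap hh hh_proj hh_cov).
Qed.
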